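(* Let $k$ be a field of characteristic $p$, $G$ a profinite group, $B$ a block of $G$ over $k$ with defect group $D$, and let $P$ be a $p$-Sylow subgroup of $G$ containing $D$. Then $D$ is open in $P$.
   Context: $k$ is a discrete field of prime characteristic $p$. For a profinite group $G$, $k[[G]]=\varprojlim_N k[G/N]$ ($N$ running over open normal subgroups) is the completed group algebra. There is a unique set $E$ of pairwise orthogonal primitive idempotents of $Z(k[[G]])$ with $k[[G]]=\prod_{e\in E}k[[G]]e$; the $k[[G]]e$ are the blocks of $G$ and the $e\in E$ the block idempotents. $G$ acts on $k[[G]]$ by conjugation, ${}^g x=gxg^{-1}$; $k[[G]]^H$ denotes the fixed points of a closed subgroup $H$. For $H$ open in $G$, $\mathrm{Tr}_H^G:k[[G]]^H\to k[[G]]^G$ is $a\mapsto\sum_{g\in G/H}{}^g a$. For $H\le G$ closed, $\mathrm{oTr}_H^G(k[[G]]^H)=\bigcap_{N}\mathrm{Tr}_{HN}^G(k[[G]]^{HN})$, over all open normal subgroups $N$ of $G$. A defect group of a block with block idempotent $e$ is a closed subgroup $D$ of $G$ with $e\in \mathrm{oTr}_D^G(k[[G]]^D)$ and minimal (under inclusion, among closed subgroups) with this property. *)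

(* Defs.v *)
From HB Require Import structures.
From mathcomp Require Import all_boot all_order all_algebra fingroup.
From mathcomp Require Import generic_quotient finmap.
From mathcomp Require Import all_classical topology.

Set Implicit Arguments.
Unset Strict Implicit.
Unset Printing Implicit Defensive.

Import GRing.Theory.

Local Open Scope classical_set_scope.
Local Open Scope quotient_scope.
Local Open Scope ring_scope.

HB.mixin Record isTopologicalGroup G & monoid.Group G & Topological G := {
  mulg_continuous : continuous (fun xy : G * G => (xy.1 * xy.2)%g);
  invg_continuous : continuous (fun x : G => (x^-1)%g)
}.

#[short(type="topGroupType")]
HB.structure Definition TopGroup :=
  {G of monoid.Group G & Topological G & isTopologicalGroup G}.

HB.mixin Record TopGroup_isProfinite G & TopGroup G := {
  profinite_compact : compact [set: G];
  profinite_hausdorff : hausdorff_space G;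
  profinite_totally_disconnected : totally_disconnected [set: G]
}.

#[short(type="profiniteType")]
HB.structure Definition Profinite := {G of TopGroup G & TopGroup_isProfinite G}.

(* compact_cover is stated for pointed spaces *)
Section CompactCover.
Variable G : topGroupType.

Let pG : Type := G.
HB.instance Definition _ := Topological.on pG.
HB.instance Definition _ := isPointed.Build pG (1%g : G).

Lemma group_compact_cover : @compact G = @cover_compact G.
Proof. exact: (@compact_cover pG). Qed.

End CompactCover.

Section Subgroups.
Variable G : topGroupType.
Implicit Types (H K U : set G).

Definition subgroup H : Prop :=
  [/\ H 1%g, forall x y, H x -> H y -> H (x * y)%g &
      forall x, H x -> H (x^-1)%g].

Definition closed_subgroup H : Prop := subgroup H /\ closed H.

Definition setmulg H K : set G := [set (x * y)%g | x in H & y in K].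

Definition normalized_by U K : Prop :=
  forall g x, K g -> U x -> U (g * x * g^-1)%g.

Definition left_coset (x : G) H : set G := [set (x * h)%g | h in H].

Definition left_cosets K H : set (set G) := [set left_coset x H | x in K].

(* [K : H], with the dummy value 0 when it is infinite. *)
Definition indexg K H : nat := #|` fset_set (left_cosets K H)|%fset.

Record open_normal := OpenNormal {
  on_set :> set G;
  on_subgroup : subgroup on_set;
  on_normal : normalized_by on_set [set: G];
  on_open : open on_set }.

Definition pro_p (p : nat) H : Prop :=
  forall U, U `<=` H -> subgroup U -> normalized_by U H ->
    open (U : set (subspace H)) -> p.-nat (indexg H U).

(* The last condition says that p does not divide the supernatural number
   [G : H], the least common multiple of the [G : HN]. *)
Definition sylow_subgroup (p : nat) H : Prop :=
  [/\ closed_subgroup H, pro_p p H &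
      forall N : open_normal, ~~ (p %| indexg [set: G] (setmulg H N))%N].

End Subgroups.

Section FiniteQuotient.
Variables (G : profiniteType) (N : open_normal G).
Implicit Types x y g : G.

Let N1 : on_set N 1%g. Proof. by case: (on_subgroup N). Qed.
Let NM x y : on_set N x -> on_set N y -> on_set N (x * y)%g.
Proof. by case: (on_subgroup N) => _ + _; apply. Qed.
Let NV x : on_set N x -> on_set N (x^-1)%g.
Proof. by case: (on_subgroup N) => _ _; apply. Qed.
Let NJ x g : on_set N x -> on_set N (g^-1 * x * g)%g.
Proof. by move=> Nx; rewrite -{2}[g]invgK; apply: on_normal. Qed.

Definition coset_rel : rel G := fun x y => `[< on_set N (x^-1 * y)%g >].

Lemma coset_rel_refl : reflexive coset_rel.
Proof. by move=> x; apply/asboolP; rewrite mulVg. Qed.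

Lemma coset_rel_sym : symmetric coset_rel.
Proof.
move=> x y; apply/asboolP/asboolP => /NV.
  by rewrite invgM invgK.
by rewrite invgM invgK.
Qed.

Lemma coset_rel_trans : transitive coset_rel.
Proof.
move=> y x z /asboolP Nxy /asboolP Nyz; apply/asboolP.
by have := NM Nxy Nyz; rewrite mulgA mulgK.
Qed.

Canonical coset_rel_equiv :=
  EquivRel coset_rel coset_rel_refl coset_rel_sym coset_rel_trans.

Definition quot := {eq_quot coset_rel}.

HB.instance Definition _ := Choice.on quot.
HB.instance Definition _ := EqQuotient.on quot.

Lemma quot_eqP x y : \pi_quot x = \pi_quot y <-> on_set N (x^-1 * y)%g.
Proof. by split=> [/eqmodP/asboolP|Nxy] //; apply/eqmodP/asboolP. Qed.

Lemma quot_pi (a : quot) : exists x, a = \pi_quot x.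
Proof. by exists (repr a); rewrite reprK. Qed.

Let quot_one : quot := \pi_quot 1%g.
Let quot_mul (a b : quot) : quot := \pi_quot (repr a * repr b)%g.
Let quot_inv (a : quot) : quot := \pi_quot ((repr a)^-1)%g.

Let quot_mulE x y : quot_mul (\pi_quot x) (\pi_quot y) = \pi_quot (x * y)%g.
Proof.
apply/quot_eqP; set x' := repr _; set y' := repr _.
have /quot_eqP Nx : \pi_quot x' = \pi_quot x by rewrite reprK.
have /quot_eqP Ny : \pi_quot y' = \pi_quot y by rewrite reprK.
have := NM (NJ y' Nx) Ny.
by rewrite invgM !mulgA mulgK.
Qed.

Let quot_invE x : quot_inv (\pi_quot x) = \pi_quot (x^-1)%g.
Proof.
apply/quot_eqP; set x' := repr _.
have /quot_eqP Nx : \pi_quot x = \pi_quot x' by rewrite reprK.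
rewrite invgK; have := NJ (x'^-1)%g Nx.
by rewrite invgK !mulgA mulgK.
Qed.

Let quot_mulA : associative quot_mul.
Proof.
move=> a b c; have [x ->] := quot_pi a; have [y ->] := quot_pi b; have [z ->] := quot_pi c.
by rewrite !quot_mulE mulgA.
Qed.
Let quot_mul1 : left_id quot_one quot_mul.
Proof. by move=> a; have [x ->] := quot_pi a; rewrite quot_mulE mul1g. Qed.
Let quot_mulr1 : right_id quot_one quot_mul.
Proof. by move=> a; have [x ->] := quot_pi a; rewrite quot_mulE mulg1. Qed.
Let quot_mulV : left_inverse quot_one quot_inv quot_mul.
Proof. by move=> a; have [x ->] := quot_pi a; rewrite quot_invE quot_mulE mulVg. Qed.
Let quot_mulrV : right_inverse quot_one quot_inv quot_mul.
Proof. by move=> a; have [x ->] := quot_pi a; rewrite quot_invE quot_mulE mulgV. Qed.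

HB.instance Definition _ := monoid.isGroup.Build quot
  quot_mulA quot_mul1 quot_mulr1 quot_mulV quot_mulrV.

Lemma quot_piM x y : \pi_quot (x * y)%g = (\pi_quot x * \pi_quot y)%g.
Proof. by rewrite -quot_mulE. Qed.

Lemma quot_finite : exists s : seq quot, forall a : quot, a \in s.
Proof.
have oN x : open (left_coset x N).
  have -> : left_coset x N = (fun y => x^-1 * y)%g @^-1` N.
    apply/seteqP; split=> [_ [h Nh <-]|y Ny] /=; first by rewrite mulKg.
    by exists (x^-1 * y)%g => //; rewrite mulKVg.
  apply: open_comp; last exact: on_open.
  move=> y _; apply: (@continuous_comp _ _ _ (fun y => (x^-1, y)%g)
    (fun xy : G * G => xy.1 * xy.2)%g); last exact: mulg_continuous.
  by apply: cvg_pair => //; exact: cvg_cst.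
have : cover_compact [set: G] by rewrite -group_compact_cover; exact: profinite_compact.
move=> /(_ G setT (fun x => left_coset x N) (fun x _ => oN x)) [|D _ cov].
  by move=> x _; exists x => //; exists 1%g; rewrite ?mulg1.
exists [seq \pi_quot x | x <- enum_fset D] => a; have [x ->] := quot_pi a.
have [y /= yD [h Nh yh]] := cov x I.
apply/mapP; exists y => //; apply/esym/quot_eqP.
by rewrite -yh mulKg.
Qed.

Let quot_enum := undup (projT1 (cid quot_finite)).
Let mem_quot_enum a : a \in quot_enum.
Proof. by rewrite mem_undup; case: (cid _) => s /= ->. Qed.

Let quot_pickle (a : quot) : nat := index a quot_enum.
Let quot_unpickle (i : nat) : option quot := ohead (drop i quot_enum).
Let quot_pickleK : pcancel quot_pickle quot_unpickle.
Proof.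
by move=> a; rewrite /quot_unpickle (drop_nth a) ?index_mem //= nth_index.
Qed.
HB.instance Definition _ := PCanIsCountable quot_pickleK.

Let quot_enumP : Finite.axiom quot_enum.
Proof. by move=> a; rewrite count_uniq_mem ?undup_uniq // mem_quot_enum. Qed.
HB.instance Definition _ := isFinite.Build quot quot_enumP.

End FiniteQuotient.

Arguments quot {G} N.

(* The canonical projection G / M -> G / N when M is contained in N. *)
Definition quot_proj (G : profiniteType) (M N : open_normal G)
  (a : quot M) : quot N := \pi_(quot N) (repr a).

Section QuotProj.
Variables (G : profiniteType) (M N : open_normal G) (MN : M `<=` N).

Lemma quot_projE (x : G) :
  quot_proj N (\pi_(quot M) x) = \pi_(quot N) x.
Proof.
by apply/quot_eqP/MN/quot_eqP; rewrite reprK.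
Qed.

Lemma quot_projM : {morph @quot_proj G M N : a b / (a * b)%g >-> (a * b)%g}.
Proof.
move=> a b; have [x ->] := quot_pi a; have [y ->] := quot_pi b.
by rewrite -quot_piM !quot_projE quot_piM.
Qed.

Lemma quot_proj1 : quot_proj N (1%g : quot M) = 1%g.
Proof. exact: quot_projE. Qed.

End QuotProj.

(* The group algebra R[Q] of a finite group Q: functions Q -> R with the
   convolution product (and not the pointwise product of {ffun Q -> R}). *)
Definition group_algebra (R : nzRingType) (Q : finGroupType) : Type :=
  {ffun Q -> R}.

Section GroupAlgebra.
Variables (R : nzRingType) (Q : finGroupType).
Local Notation A := (group_algebra R Q).

HB.instance Definition _ := GRing.Zmodule.copy A {ffun Q -> R}.

Definition galg_elt (q : Q) : A := [ffun h => (h == q)%:R].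

Definition galg_mul (x y : A) : A := [ffun q => \sum_h x h * y (h^-1 * q)%g].

Lemma galg_addE (x y : A) q : (x + y) q = x q + y q.
Proof. exact: ffunE. Qed.

Lemma galg_elt_mulE g (y : A) q : galg_mul (galg_elt g) y q = y (g^-1 * q)%g.
Proof.
rewrite ffunE (bigD1 g) //= ffunE eqxx mul1r big1 ?addr0 // => h hg.
by rewrite ffunE (negPf hg) mul0r.
Qed.

Let mulA : associative galg_mul.
Proof.
move=> x y z; apply/ffunP=> q; rewrite !ffunE.
under eq_bigr do rewrite ffunE mulr_sumr.
under [RHS]eq_bigr do rewrite ffunE mulr_suml.
rewrite [RHS]exchange_big; apply: eq_bigr => h _ /=.
rewrite [RHS](reindex_inj (mulgI h)) /=; apply: eq_bigr => g _.
by rewrite mulKg invgM mulrA mulgA.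
Qed.

Let mul1 : left_id (galg_elt 1%g) galg_mul.
Proof. by move=> x; apply/ffunP=> q; rewrite galg_elt_mulE invg1 mul1g. Qed.

Let mulr1 : right_id (galg_elt 1%g) galg_mul.
Proof.
move=> x; apply/ffunP=> q; rewrite ffunE (bigD1 q) //= ffunE mulVg eqxx mulr1.
rewrite big1 ?addr0 // => h hq; rewrite ffunE -(inj_eq (mulgI h)) mulKVg mulg1.
by rewrite eq_sym (negPf hq) mulr0.
Qed.

Let mulDl : left_distributive galg_mul +%R.
Proof.
move=> x y z; apply/ffunP=> q; rewrite galg_addE !ffunE -big_split.
by apply: eq_bigr => h _; rewrite galg_addE mulrDl.
Qed.

Let mulDr : right_distributive galg_mul +%R.
Proof.
move=> x y z; apply/ffunP=> q; rewrite galg_addE !ffunE -big_split.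
by apply: eq_bigr => h _; rewrite galg_addE mulrDr.
Qed.

Let one_neq0 : galg_elt 1%g != 0.
Proof.
by apply/eqP => /ffunP/(_ 1%g)/eqP; rewrite !ffunE eqxx oner_eq0.
Qed.

HB.instance Definition _ := GRing.Zmodule_isNzRing.Build A
  mulA mul1 mulr1 mulDl mulDr one_neq0.

Lemma galg_mulE (x y : A) q : (x * y) q = \sum_h x h * y (h^-1 * q)%g.
Proof. exact: ffunE. Qed.

Lemma galg_1E : 1 = galg_elt 1%g :> A. Proof. by []. Qed.

Lemma galg_eltM g h : galg_elt (g * h)%g = galg_elt g * galg_elt h.
Proof.
apply/ffunP=> q; rewrite galg_elt_mulE !ffunE.
by rewrite -(inj_eq (mulgI g) _ h) mulKVg.
Qed.

End GroupAlgebra.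

(* The ring morphism R[Q1] -> R[Q2] induced by a group morphism phi. *)
Definition galg_map (R : nzRingType) (Q1 Q2 : finGroupType) (phi : Q1 -> Q2)
  (x : group_algebra R Q1) : group_algebra R Q2 :=
  [ffun q => \sum_(r | phi r == q) x r].

Section GroupAlgebraMap.
Variables (R : nzRingType) (Q1 Q2 : finGroupType) (phi : Q1 -> Q2).
Local Notation map := (@galg_map R Q1 Q2 phi).

Lemma galg_map0 : map 0 = 0.
Proof.
by apply/ffunP=> q; rewrite !ffunE big1 // => r _; rewrite ffunE.
Qed.

Lemma galg_mapD : {morph map : x y / x + y}.
Proof.
move=> x y; apply/ffunP=> q; rewrite galg_addE !ffunE -big_split.
by apply: eq_bigr => r _; rewrite galg_addE.
Qed.

Lemma galg_mapN : {morph map : x / - x}.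
Proof.
move=> x; apply/ffunP=> q; rewrite !ffunE -sumrN.
by apply: eq_bigr => r _; rewrite ffunE.
Qed.

Lemma galg_map_elt g : map (galg_elt R g) = galg_elt R (phi g).
Proof.
apply/ffunP=> q; rewrite !ffunE; case: (eqVneq q (phi g)) => [->|qg].
  rewrite (bigD1 g) //= ffunE eqxx big1 ?addr0 // => r /andP[_ rg].
  by rewrite ffunE (negPf rg).
rewrite big1 // => r /eqP rq; rewrite ffunE; case: eqP => // rg.
by rewrite -rq rg eqxx in qg.
Qed.

Hypothesis phiM : {morph phi : a b / (a * b)%g >-> (a * b)%g}.

Lemma galg_mapM : {morph map : x y / x * y}.
Proof.
move=> x y; apply/ffunP=> q; rewrite galg_mulE ffunE.
under eq_bigr do rewrite galg_mulE.
rewrite exchange_big (partition_big phi xpredT) //=; apply: eq_bigr => s _.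
rewrite [map x s]ffunE mulr_suml; apply: eq_bigr => h /eqP hs.
rewrite ffunE mulr_sumr (reindex_inj (mulgI h)) /=.
apply: eq_big => [r|r _]; last by rewrite mulKg.
by rewrite phiM hs -(inj_eq (mulgI s) _ (s^-1 * q)%g) mulKVg.
Qed.

End GroupAlgebraMap.

(* k[[G]], the inverse limit of the k[G / N] over the open normal subgroups N *)
Record completed_algebra (k : fieldType) (G : profiniteType) := CompletedAlgebra {
  ca_val :> forall N : open_normal G, group_algebra k (quot N);
  ca_compat : forall M N : open_normal G, M `<=` N ->
    galg_map (@quot_proj G M N) (ca_val M) = ca_val N }.

Section CompletedAlgebra.
Variables (k : fieldType) (G : profiniteType).
Local Notation kG := (completed_algebra k G).

HB.instance Definition _ := gen_eqMixin kG.
HB.instance Definition _ := gen_choiceMixin kG.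

Lemma caP (x y : kG) : (forall N, x N = y N) -> x = y.
Proof.
case: x y => [x xP] [y yP] /= exy.
have xy : x = y by exact: functional_extensionality_dep.
by subst y; congr CompletedAlgebra; exact: Prop_irrelevance.
Qed.

Let zero : kG.
Proof. by exists (fun=> 0) => M N MN; exact: galg_map0. Defined.
Let add (x y : kG) : kG.
Proof.
by exists (fun N => x N + y N) => M N MN; rewrite galg_mapD !ca_compat.
Defined.
Let opp (x : kG) : kG.
Proof. by exists (fun N => - x N) => M N MN; rewrite galg_mapN ca_compat. Defined.
Let mul (x y : kG) : kG.
Proof.
exists (fun N => x N * y N) => M N MN.
by rewrite galg_mapM ?ca_compat //; exact: quot_projM.
Defined.

Definition ca_elt (g : G) : kG.
Proof.
exists (fun N => galg_elt k (\pi_(quot N) g)) => M N MN.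
by rewrite galg_map_elt quot_projE.
Defined.

Let addA : associative add.
Proof. by move=> x y z; apply: caP => N; exact: addrA. Qed.
Let addC : commutative add.
Proof. by move=> x y; apply: caP => N; exact: addrC. Qed.
Let add0 : left_id zero add.
Proof. by move=> x; apply: caP => N; exact: add0r. Qed.
Let addN : left_inverse zero opp add.
Proof. by move=> x; apply: caP => N; exact: addNr. Qed.

HB.instance Definition _ := GRing.isZmodule.Build kG addA addC add0 addN.

Let mulA : associative mul.
Proof. by move=> x y z; apply: caP => N; exact: mulrA. Qed.
Let mul1 : left_id (ca_elt 1%g) mul.
Proof. by move=> x; apply: caP => N; exact: mul1r. Qed.
Let mul1' : right_id (ca_elt 1%g) mul.
Proof. by move=> x; apply: caP => N; exact: mulr1. Qed.
Let mulDl : left_distributive mul +%R.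
Proof. by move=> x y z; apply: caP => N; exact: mulrDl. Qed.
Let mulDr : right_distributive mul +%R.
Proof. by move=> x y z; apply: caP => N; exact: mulrDr. Qed.

Let whole : open_normal G.
Proof. by exists [set: G] => //; exact: openT. Defined.

Let one_neq0 : ca_elt 1%g != 0.
Proof.
apply/eqP => /(congr1 (fun x : kG => x whole)) /= /eqP.
by rewrite -[galg_elt _ _]galg_1E oner_eq0.
Qed.

HB.instance Definition _ := GRing.Zmodule_isNzRing.Build kG
  mulA mul1 mul1' mulDl mulDr one_neq0.

Lemma ca_0E N : (0 : kG) N = 0. Proof. by []. Qed.
Lemma ca_1E N : (1 : kG) N = 1. Proof. by []. Qed.
Lemma ca_addE (x y : kG) N : (x + y) N = x N + y N. Proof. by []. Qed.
Lemma ca_oppE (x : kG) N : (- x) N = - x N. Proof. by []. Qed.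
Lemma ca_mulE (x y : kG) N : (x * y) N = x N * y N. Proof. by []. Qed.
Lemma ca_eltM g h : ca_elt (g * h)%g = ca_elt g * ca_elt h.
Proof. by apply: caP => N; rewrite ca_mulE /= quot_piM galg_eltM. Qed.

End CompletedAlgebra.

Section Blocks.
Variables (k : fieldType) (G : profiniteType).
Local Notation kG := (completed_algebra k G).
Implicit Types (e x : kG) (E B : set kG) (H D : set G).

Definition central_idempotent e : Prop :=
  (forall x, GRing.comm e x) /\ e * e = e.

Definition primitive_central_idempotent e : Prop :=
  [/\ central_idempotent e, e <> 0 &
      forall f g : kG, central_idempotent f -> central_idempotent g ->
        f * g = 0 -> e = f + g -> f = 0 \/ g = 0].

Definition principal_ideal e : set kG := [set x * e | x in [set: kG]].

(* The last condition is the bijectivity of the map x |-> (xe)_e from k[[G]]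
   to the product of the k[[G]]e, for e in E. *)
Definition block_idempotents E : Prop :=
  [/\ forall e, E e -> primitive_central_idempotent e,
      forall e f, E e -> E f -> e <> f -> e * f = 0 &
      forall y : kG -> kG, (forall e, E e -> principal_ideal e (y e)) ->
        exists! x, forall e, E e -> x * e = y e].

Definition block_with_idempotent B e : Prop :=
  (exists2 E, block_idempotents E & E e) /\ B = principal_ideal e.

Definition is_block B : Prop := exists e, block_with_idempotent B e.

Definition ca_conj (g : G) x : kG := ca_elt k g * x * ca_elt k (g^-1)%g.

Definition ca_fixed H : set kG := [set x | forall h, H h -> ca_conj h x = x].

(* Tr_H^G for H open in G and x in k[[G]]^H: the sum does not depend on the
   representatives chosen in the cosets, and it is finite. *)
Definition ca_trace H x : kG :=
  \sum_(C \in left_cosets [set: G] H) ca_conj (xget 1%g C) x.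

(* oTr_D^G (k[[G]]^D) *)
Definition open_trace_image D : set kG :=
  \bigcap_(N in [set: open_normal G])
    [set ca_trace (setmulg D N) x | x in ca_fixed (setmulg D N)].

Definition is_defect_group B D : Prop :=
  exists2 e, block_with_idempotent B e &
    [/\ closed_subgroup D, open_trace_image D e &
        forall D', closed_subgroup D' -> D' `<=` D ->
          open_trace_image D' e -> D' = D].

End Blocks.

(* Main.v *)
(** Let e be the block idempotent and N an open normal subgroup with nonzero
    image e_N of e in k[G/N]. For every open normal M contained in N, e is a
    trace from DM. Conjugation by N is trivial on k[G/N], so the trace from DM
    to DN multiplies by the index [DN : DM] there, which is therefore prime
    to p. Since P is pro-p, the image of P ∩ DN in G/M is a p-group between
    those of D and DN, hence equals that of D. Thus P ∩ DN lies in the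
    intersection of the DM, which is D because D is closed; so D = P ∩ DN,
    and DN is open. *)

Require Import Defs.
From HB Require Import structures.
From mathcomp Require Import all_boot all_order all_algebra fingroup.
From mathcomp Require Import all_classical topology.

Set Implicit Arguments.
Unset Strict Implicit.
Unset Printing Implicit Defensive.

Import GRing.Theory.

Local Open Scope quotient_scope.

(** * Sums over cosets in characteristic p *)

(** Group the cosets of [H] by the coset of [K] containing them: [f] is constant on each group,
    which has [#|K : H|] members, a multiple of [p]. *)
Lemma sum_lcosets_eq0 (p : nat) (gT : finGroupType) (V : zmodType)
    (H K : {group gT}) (f : gT -> V) :
  (forall v : V, v *+ p = 0)%R -> H \subset K -> p %| #|K : H|%g ->
  (forall g r, r \in K -> f (g * r)%g = f g) ->
  (\sum_(A in lcosets H [set: gT]%SET) f (repr A) = 0)%R.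
Proof.
move=> pV sHK pKH fK.
rewrite (partition_big (fun A => repr A *: K)%g (mem (lcosets K [set: gT]%SET))) /=; last first.
  by move=> A _; apply/lcosetsP; exists (repr A).
apply: big1 => C /lcosetsP[g _ ->].
(* Translation by [g] carries the cosets of [H] in [K] onto those in [gK], which gives the size of
   the fibre. *)
have E : [set A in lcosets H [set: gT]%SET | (repr A *: K == g *: K)%g]
         = [set (g *: B)%g | B : {set gT} in lcosets H K].
  apply/setP => A; rewrite inE; apply/andP/imsetP.
    move=> [/lcosetsP[x _ ->]] /eqP xgK.
    exists (g^-1 *: (x *: H))%g; last by rewrite -!lcosetM mulgV mul1g.
    apply/lcosetsP; exists (g^-1 * x)%g; last by rewrite lcosetM.
    rewrite -mem_lcoset.
    have : repr (x *: H)%g \in (g *: K)%g by rewrite -xgK lcoset_refl.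
    case/lcosetP: (mem_repr _ (lcoset_refl H x)) => h Hh -> {xgK}.
    rewrite !mem_lcoset !mulgA => gxh.
    by rewrite -(groupMr _ (fintype.subsetP sHK _ Hh)).
  move=> [_ /lcosetsP[x Kx ->] ->]; split.
    by apply/lcosetsP; exists (g * x)%g; rewrite ?inE ?lcosetM.
  rewrite -lcosetM; case/lcosetP: (mem_repr _ (lcoset_refl H (g * x)%g)) => h Hh ->.
  apply/eqP; rewrite -mulgA lcosetM; congr (_ *: _)%g.
  by rewrite lcoset_id // groupM // (fintype.subsetP sHK).
rewrite (eq_bigr (fun=> f g)) => [|A /andP[_ /eqP AgK]]; last first.
  have : repr A \in (g *: K)%g by rewrite -AgK lcoset_refl.
  by case/lcosetP => r Kr ->; exact: fK.
rewrite sumr_const.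
have -> : #|[pred A | (A \in lcosets H [set: gT]%SET) && (repr A *: K == g *: K)%g]| = #|K : H|%g.
  rewrite -card_lcosets -(card_imset _ (can_inj (lcosetK g))) -E.
  by apply: eq_card => A; rewrite [in RHS]inE.
by case/dvdnP: pKH => m ->; rewrite mulnC mulrnA pV mul0rn.
Qed.

Local Open Scope classical_set_scope.

(** * Topology of profinite groups *)

(** Normality yields a neighbourhood [C] of [A] whose closure misses [B]; its interior and the
    complement of its closure separate. *)
Lemma normal_space_separation (T : topologicalType) (A B : set T) :
  normal_space T -> closed A -> closed B -> A `&` B = set0 ->
  exists U V, [/\ open U, open V, A `<=` U, B `<=` V & U `&` V = set0].
Proof.
move=> nT clA clB AB0.
have /(nT A clA) [C nC CB] : set_nbhs A (~` B).
  move=> z Az; apply: open_nbhs_nbhs; split; first exact: closed_openC.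
  by move=> Bz; have : set0 z by rewrite -AB0.
exists C°, (~` closure C); split.
- exact: open_interior.
- by apply: closed_openC; exact: closed_closure.
- by move=> z /nC.
- by move=> z Bz /CB.
- apply/seteqP; split=> // z [/interior_subset Cz]; apply.
  exact: subset_closure.
Qed.

(* The intersection Q of the clopen sets containing x is connected: a splitting
   of Q extends to disjoint open sets U and V, and by compactness some clopen
   D containing x lies in their union, so D ∩ U and D ∩ V are clopen. *)
Lemma compact_zero_dimensional (T : topologicalType) :
  hausdorff_space T -> compact [set: T] -> totally_disconnected [set: T] ->
  zero_dimensional T.
Proof.
move=> hT cT tdT x y /eqP xy; apply: contrapT => noU.
pose Q := \bigcap_(D in [set D : set T | clopen D /\ D x]) D.
have Qx : Q x by move=> D [].
have Qy : Q y.
  by move=> D [cD Dx]; apply: contrapT => Dy; apply: noU; exists D.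
have clQ : closed Q by apply: closed_bigI => D [[]].
suff cQ : connected Q.
  have := @connected_component_max T setT Q x Qx (@subsetT _ _) cQ y Qy.
  by rewrite tdT // => /= yx; apply: xy.
move=> B [b Bb] [C oC BC] [C' cC' BC'].
have clB : closed B by rewrite BC'; apply: closedI.
have clA : closed (Q `\` C) by apply: closedI => //; apply: open_closedC.
have AB0 : (Q `\` C) `&` B = set0.
  by rewrite BC; apply/seteqP; split=> // z [[_ nC] [_ /nC]].
have [U [V [oU oV AU BV UV0]]] :=
  normal_space_separation (compact_normal hT cT) clA clB AB0.
have UVF z : U z -> V z -> False.
  by move=> Uz Vz; have : set0 z by rewrite -UV0.
have /compact_near_coveringP cK : compact (~` (U `|` V)).
  apply: (subclosed_compact _ cT) => //; apply: open_closedC; exact: openU.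
(* Every [z] outside [U] and [V] is outside [Q], hence avoided by some clopen [D]. Compactness along
   the filter [F] makes a single [D] avoid all of them. *)
pose F := filter_from [set D : set T | clopen D /\ D x] id.
have FF : Filter F.
  apply: filter_from_filter.
    by exists setT; split=> //; exact: clopenT.
  move=> D E [cD Dx] [cE Ex]; exists (D `&` E) => //.
  by split=> //; exact: clopenI.
have [|D [cD Dx] DK] := cK T F (fun i z => i <> z) FF.
  move=> z Kz; have : ~ Q z.
    move=> Qz; apply: Kz; have [Cz|nCz] := pselect (C z).
      by right; apply: BV; rewrite BC.
    by left; apply: AU.
  move=> nQz; have [D [cD Dx nDz]] : exists D, [/\ clopen D, D x & ~ D z].
    apply: contrapT => nD; apply: nQz => D [cD Dx].
    by apply: contrapT => nDz; apply: nD; exists D.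
  exists (~` D, D) => /=.
    split; last by exists D.
    by apply: open_nbhs_nbhs; split=> //; case: cD => _ /closed_openC.
  by move=> [z' i] /= [nDz' Di] iz'; apply: nDz'; rewrite -iz'.
have DUV z : D z -> U z \/ V z.
  by move=> Dz; apply: contrapT => nUV; exact: (DK z Dz z nUV erefl).
have clopenDU U' V' : open U' -> open V' -> (forall z, U' z -> V' z -> False) ->
    (forall z, D z -> U' z \/ V' z) -> clopen (D `&` U').
  move=> oU' oV' UV' DU'; have [oD clD] := cD.
  split; first exact: openI.
  have -> : D `&` U' = D `&` ~` V'.
    apply/seteqP; split=> z [Dz Uz]; split=> //; first by move/(UV' _ Uz).
    by case: (DU' _ Dz).
  by apply: closedI => //; exact: open_closedC.
(* Whichever of [D] ∩ [V] and [D] ∩ [U] contains [x] is clopen, so it contains [Q]. The first case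
   gives [B = Q]; the second contradicts [b] being in [V]. *)
have [Cx|nCx] := pselect (C x).
  have Vx : V x by apply: BV; rewrite BC.
  have cDV : clopen (D `&` V).
    by apply: (clopenDU V U) => // [z Vz /UVF|z /DUV []]; auto.
  apply/seteqP; split=> z; first by rewrite BC => -[].
  move=> Qz; have [_ Vz] := Qz _ (conj cDV (conj Dx Vx)).
  rewrite BC; split=> //; apply: contrapT => nCz.
  by apply: (UVF z) => //; apply: AU.
have Ux : U x by apply: AU.
have cDU : clopen (D `&` U) by exact: (clopenDU U V).
have Qb : Q b by move: Bb; rewrite BC => -[].
have [_ Ub] := Qb _ (conj cDU (conj Dx Ux)).
by case: (UVF b Ub); exact: BV.
Qed.

Lemma clopen_near (T : topologicalType) (V : set T) (x : T) :
  clopen V -> \forall y \near x, V y <-> V x.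
Proof.
move=> [oV clV]; have [Vx|nVx] := pselect (V x).
  by have := open_nbhs_nbhs (conj oV Vx : open_nbhs x V); apply: filterS.
have := open_nbhs_nbhs (conj (closed_openC clV) nVx : open_nbhs x (~` V)).
by apply: filterS => y nVy; split.
Qed.

Lemma mulg_cvg (G : topGroupType) (T : Type) (F : set_system T)
    {FF : Filter F} (f g : T -> G) (a b : G) :
  f @ F --> a -> g @ F --> b -> (fun t => f t * g t)%g @ F --> (a * b)%g.
Proof.
move=> fa gb.
exact: (@continuous2_cvg _ _ _ _ _ _ f g (fun x y => (x * y)%g) a b
  (@mulg_continuous G (a, b)) fa gb).
Qed.

Lemma mulg_continuousl (G : topGroupType) (a : G) : continuous (fun x => (a * x)%g).
Proof. by move=> x; apply: mulg_cvg; [exact: cvg_cst|exact: cvg_id]. Qed.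

(** Links the topological definition of profinite groups to their finite quotients. *)
Lemma open_normal_base (G : profiniteType) (W : set G) :
  nbhs 1%g W -> exists N : open_normal G, N `<=` W.
Proof.
move=> W1.
have hG := @profinite_hausdorff G; have cG := @profinite_compact G.
have zG := compact_zero_dimensional hG cG (@profinite_totally_disconnected G).
have [V [V1 cV] VW] := @zero_dimensional_cvg G 1%g hG zG cG _ W1.
(* The two-sided syntactic stabilizer of V is a normal subgroup contained in V;
   it is open by compactness of G * G. *)
pose S : set G := [set g | forall a b, V (a * g * b)%g <-> V (a * b)%g].
have S1 : S 1%g by move=> a b; rewrite mulg1.
have SM x y : S x -> S y -> S (x * y)%g.
  by move=> Sx Sy a b; rewrite mulgA Sy Sx.
have SV x : S x -> S (x^-1)%g.
  by move=> Sx a b; rewrite -(Sx (a * x^-1)%g b) mulgVK.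
have Snormal : normalized_by S [set: G].
  move=> g x _ Sx a b; have := Sx (a * g)%g (g^-1 * b)%g.
  by rewrite !mulgA mulgK.
have oS : open S.
  rewrite openE => g Sg; rewrite /interior.
  have /compact_near_coveringP cGG := compact_setX cG cG.
  pose inv_V g' (ab : G * G) := V (ab.1 * g' * ab.2)%g <-> V (ab.1 * ab.2)%g.
  have near_g : forall ab : G * G, (setT `*` setT) ab ->
      \forall ab' \near ab & g' \near g, inv_V g' ab'.
    move=> [a b] _.
    have c1 : (fun w : G * G * G => w.1.1) @ filter_prod (nbhs (a, b)) (nbhs g) --> a.
      by apply: cvg_comp; [exact: cvg_fst|exact: cvg_fst].
    have c2 : (fun w : G * G * G => w.1.2) @ filter_prod (nbhs (a, b)) (nbhs g) --> b.
      by apply: cvg_comp; [exact: cvg_fst|exact: cvg_snd].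
    have c3 : (fun w : G * G * G => w.2) @ filter_prod (nbhs (a, b)) (nbhs g) --> g.
      exact: cvg_snd.
    (* As [V] is clopen, both memberships are locally constant, and they agree at [(a, b, g)]
       because [g] is in [S]. *)
    have n1 : \forall ab' \near (a, b) & g' \near g,
        V (ab'.1 * g' * ab'.2)%g <-> V (a * g * b)%g.
      exact: (mulg_cvg (mulg_cvg c1 c3) c2 (clopen_near (a * g * b)%g cV)).
    have n2 : \forall ab' \near (a, b) & g' \near g,
        V (ab'.1 * ab'.2)%g <-> V (a * b)%g.
      exact: (mulg_cvg c1 c2 (clopen_near (a * b)%g cV)).
    have FF : Filter (filter_prod (nbhs (a, b)) (nbhs g)).
      exact: filter_prod_filter.
    apply: (@filterS _ _ FF) (@filterI _ _ FF _ _ n1 n2).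
    by move=> [[a' b'] g']; rewrite /inv_V => -[/= -> ->]; exact: Sg.
  have nS : nbhs g [set g' | setT `*` setT `<=` inv_V g'].
    exact: (cGG _ _ inv_V _ near_g).
  by apply: filterS nS => g' Sg' a b; exact: (Sg' (a, b)).
exists (OpenNormal (And3 S1 SM SV) Snormal oS) => g Sg.
(* With [a = b = 1], membership of [g] in [V] reduces to that of 1. *)
apply: VW; have := Sg 1%g 1%g.
by rewrite !mulg1 mul1g => ->.
Qed.

(** If [x] is not in [D], some [M] inside [N] has [xM] disjoint from [D]; but [x = dm] would put
    [x * m^-1 = d] in [D]. *)
Lemma closed_bigcap_setmulg (G : profiniteType) (N : open_normal G) (D : set G) (x : G) :
  closed D ->
  (forall M : open_normal G, M `<=` N -> setmulg D M x) -> D x.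
Proof.
move=> clD DM; apply: contrapT => nDx.
have : nbhs 1%g [set m | ~ D (x * m)%g].
  have := @mulg_continuousl G x 1%g (~` D); apply.
  rewrite mulg1; apply: open_nbhs_nbhs; split=> //; exact: closed_openC.
have N1 : nbhs 1%g (N : set G).
  apply: open_nbhs_nbhs; split; first exact: on_open.
  by case: (on_subgroup N).
move=> /filterI /(_ N1) /open_normal_base[M MW].
have [d Dd [m Mm dmx]] := DM M (fun z Mz => (MW z Mz).2).
have [_ _ MV] := on_subgroup M.
have [/= nD _] := MW _ (MV _ Mm).
by apply: nD; rewrite -dmx mulgK.
Qed.

(** Moves traces and indices, defined over classical sets of cosets, to finite types, where finite
    group theory applies. *)
Lemma fsbig_finset_bij (R : Type) (idx : R) (op : Monoid.com_law idx)
    (I : finType) (J : choiceType) (S : {set I}) (Q : set J) (h : I -> J) (F : J -> R) :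
  set_bij [set i | i \in S] Q h ->
  \big[op/idx]_(j \in Q) F j = \big[op/idx]_(i in S) F (h i).
Proof.
move=> hb; rewrite (reindex_fsbig _ _ _ _ hb); apply/esym.
by apply: (bigfs op (index_enum_uniq I)) => i _; rewrite mem_index_enum.
Qed.

(** * Images of subgroups in the finite quotients G/M *)

Section QuotImage.
Variables (G : profiniteType) (M : open_normal G).
Implicit Types A : set G.

Definition quot_image A : {set quot M} :=
  finset (fun q => `[< exists2 x, A x & \pi_(quot M) x = q >]).

Lemma quot_imageP A q :
  reflect (exists2 x, A x & \pi_(quot M) x = q) (q \in quot_image A).
Proof. by rewrite inE; exact: asboolP. Qed.

Lemma mem_quot_image A x : A x -> \pi_(quot M) x \in quot_image A.
Proof. by move=> Ax; apply/quot_imageP; exists x. Qed.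

Lemma quot_piV x : \pi_(quot M) (x^-1)%g = (\pi_(quot M) x)^-1%g.
Proof. by apply/eqP; rewrite eq_sym eq_invg_mul -quot_piM mulgV. Qed.

Lemma group_set_quot_image A : subgroup A -> group_set (quot_image A).
Proof.
move=> [A1 AM AV]; apply/group_setP; split; first exact: (mem_quot_image A1).
move=> _ _ /quot_imageP[x Ax <-] /quot_imageP[y Ay <-].
by rewrite -quot_piM; apply: mem_quot_image; exact: AM.
Qed.

Lemma setmulg_quot_image A x : setmulg A M x <-> \pi_(quot M) x \in quot_image A.
Proof.
split.
  move=> [a Aa [m Mm <-]]; apply/quot_imageP; exists a => //.
  by apply/quot_eqP; rewrite mulKg.
move=> /quot_imageP[a Aa /quot_eqP Mx]; exists a => //.
by exists (a^-1 * x)%g; rewrite // mulKVg.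
Qed.

(** Since [AM] is the full preimage of the image of [A], its cosets are the preimages of the cosets
    of that image. This reindexes [ca_trace]. *)
Lemma left_cosets_quot_bij A : subgroup A ->
  set_bij [set C | C \in lcosets (quot_image A) (finset.setTfor (quot M))]
    (left_cosets [set: G] (setmulg A M))
    (fun C : {set quot M} => [set x | \pi_(quot M) x \in C]).
Proof.
move=> sA; have preE x : left_coset x (setmulg A M) =
    [set y | \pi_(quot M) y \in \pi_(quot M) x *: quot_image A]%g.
  apply/seteqP; split=> y /=.
    move=> [h /setmulg_quot_image Ah <-].
    by rewrite mem_lcoset quot_piM mulKg.
  rewrite mem_lcoset -quot_piV -quot_piM => /setmulg_quot_image xy.
  by exists (x^-1 * y)%g; rewrite // mulKVg.
split.
- move=> C /= /lcosetsP[q _ ->]; have [x ->] := quot_pi q.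
  by exists x => //; rewrite preE.
- move=> C C' _ _ CC'; apply/setP => q; have [x ->] := quot_pi q.
  by have := congr1 (fun U : set G => U x) CC' => /= /propeqP [? ?]; apply/idP/idP.
- move=> _ [x _ <-]; exists (\pi_(quot M) x *: quot_image A)%g => /=.
    by apply/lcosetsP; exists (\pi_(quot M) x); rewrite ?inE.
  by rewrite preE.
Qed.

(** The cosets of [A] ∩ [M] in [A] are the fibres of the projection from [A] to G/M. *)
Lemma indexg_quot_image A : subgroup A -> Defs.indexg A (A `&` M) = #|quot_image A|.
Proof.
move=> [A1 AM AV].
have bij : set_bij [set q | q \in quot_image A] (left_cosets A (A `&` M))
    (fun q => [set x | A x /\ \pi_(quot M) x = q]).
  have preE x : A x -> left_coset x (A `&` M) =
      [set y | A y /\ \pi_(quot M) y = \pi_(quot M) x].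
    move=> Ax; apply/seteqP; split=> y /=.
      move=> [m [Am Mm] <-]; split; first exact: AM.
      by apply/esym/quot_eqP; rewrite mulKg.
    move=> [Ay /esym/quot_eqP Mxy]; exists (x^-1 * y)%g; last by rewrite mulKVg.
    by split=> //; apply: AM => //; exact: AV.
  split.
  - by move=> _ /= /quot_imageP[x Ax <-]; exists x => //; rewrite preE.
  - move=> q q' /set_mem /= /quot_imageP[x Ax <-] _.
    move=> /(congr1 (fun U : set G => U x)) /= /propeqP [E _].
    by case: E.
  - move=> _ [x Ax <-]; exists (\pi_(quot M) x) => /=; first exact: mem_quot_image.
    by rewrite preE.
(* Finiteness excludes the dummy value 0 of [indexg]. *)
have fin : finite_set (left_cosets A (A `&` M)).
  rewrite -(surj_image_eq (set_bij_sub bij) (set_bij_surj bij)).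
  by apply: finite_image; exact: finite_finpred.
rewrite /Defs.indexg -sum1_size -fsbig_finite // (fsbig_finset_bij _ _ bij).
by rewrite sum1_card.
Qed.

End QuotImage.

Lemma subgroup_setmulg (G : topGroupType) (D : set G) (N : open_normal G) :
  subgroup D -> subgroup (setmulg D N).
Proof.
move=> [D1 DM DV]; have [N1 NM NV] := on_subgroup N.
have Nconj d n : on_set N n -> on_set N (d^-1 * n * d)%g.
  by move=> Nn; rewrite -{2}(invgK d); exact: on_normal.
split.
- by exists 1%g => //; exists 1%g; rewrite ?mulg1.
- move=> _ _ [d Dd [n Nn <-]] [d' Dd' [n' Nn' <-]].
  exists (d * d')%g; first exact: DM.
  exists (d'^-1 * n * d' * n')%g; first by apply: NM => //; exact: Nconj.
  by rewrite !mulgA mulgK.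
- move=> _ [d Dd [n Nn <-]]; exists (d^-1)%g; first exact: DV.
  exists (d * n^-1 * d^-1)%g; last by rewrite !mulgA mulVg mul1g invgM.
  by apply: on_normal => //; exact: NV.
Qed.

Lemma sub_setmulg (G : topGroupType) (D : set G) (N : open_normal G) :
  D `<=` setmulg D N.
Proof.
by move=> d Dd; exists d => //; exists 1%g; rewrite ?mulg1 //; case: (on_subgroup N).
Qed.

Lemma open_setmulg (G : topGroupType) (D : set G) (N : open_normal G) :
  open (setmulg D N).
Proof.
rewrite openE => x [d Dd [n Nn dnx]]; rewrite /interior.
have [N1 NM _] := on_subgroup N.
have : nbhs x [set y | on_set N (x^-1 * y)%g].
  have := @mulg_continuousl G (x^-1)%g x N; apply.
  by rewrite mulVg; apply: open_nbhs_nbhs; split=> //; exact: on_open.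
apply: filterS => y Nxy; exists d => //; exists (n * (x^-1 * y))%g.
  exact: NM.
by rewrite mulgA dnx mulKVg.
Qed.

(** [P] ∩ [M] is open and normal in [P], and its index is the order of the image. *)
Lemma quot_image_pgroup (G : profiniteType) (M : open_normal G) (p : nat) (P : set G) :
  subgroup P -> pro_p p P -> (p.-nat #|quot_image M P|)%N.
Proof.
move=> sP pP; rewrite -indexg_quot_image //.
have [P1 PM PV] := sP; have [M1 MM MV] := on_subgroup M.
apply: pP => [x []||g x Pg [Px Mx]|].
- by [].
- split=> // [x y [Px Mx] [Py My]|x [Px Mx]]; split.
  + exact: PM.
  + exact: MM.
  + exact: PV.
  + exact: MV.
- split; last exact: on_normal.
  by apply: (PM); [exact: PM|exact: PV].
- apply/open_subspaceP; exists M; first exact: on_open.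
  by rewrite setIAC setIid setIC.
Qed.

(** * Vanishing of traces at level N *)

Lemma galg_pchar (k : fieldType) (p : nat) (Q : finGroupType) (v : group_algebra k Q) :
  p \in [pchar k]%R -> (v *+ p = 0)%R.
Proof.
move=> kp; apply/ffunP => q.
have E n : ((v *+ n) q = v q *+ n)%R.
  elim: n => [|n IH]; first by rewrite !mulr0n ffunE.
  by rewrite !mulrS galg_addE IH.
by rewrite E ffunE mulrn_pchar.
Qed.

(** In k[G/N], conjugation by [N] is trivial and [D] fixes [x], so conjugates of [x] depend only on
    cosets of [DN], and each is repeated a multiple of [p] times. *)
Lemma ca_trace_eq0 (k : fieldType) (G : profiniteType) (p : nat)
    (M N : open_normal G) (D : set G) (x : completed_algebra k G) :
  p \in [pchar k]%R -> M `<=` N -> subgroup D ->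
  p %| #|quot_image M (setmulg D N) : quot_image M D|%g ->
  ca_fixed (setmulg D M) x -> ca_trace (setmulg D M) x N = 0%R.
Proof.
move=> kp MN sD pKH fx.
pose H := Group (group_set_quot_image M sD).
pose K := Group (group_set_quot_image M (subgroup_setmulg N sD)).
have sHK : H \subset K.
  apply/fintype.subsetP => _ /quot_imageP[d Dd <-].
  by apply: mem_quot_image; exact: sub_setmulg.
(* Conjugation of [x N] by [q], acting through the projection from G/M to G/N. *)
pose f (q : quot M) : group_algebra k (quot N) :=
  (galg_elt k (quot_proj N q) * x N * galg_elt k (quot_proj N q)^-1%g)%R.
have fK g r : r \in K -> f (g * r)%g = f g.
  case/quot_imageP => _ [d Dd [n Nn <-]] <-.
  have dn : \pi_(quot N) (d * n)%g = \pi_(quot N) d.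
    by apply/esym/quot_eqP; rewrite mulKg.
  rewrite /f quot_projM // quot_projE // dn invgM !galg_eltM.
  have := congr1 (fun y : completed_algebra k G => y N) (fx d (sub_setmulg M Dd)).
  rewrite /= -quot_piV => xd.
  by rewrite -[in RHS]xd !mulrA.
rewrite /ca_trace (fsbig_finset_bij _ _ (left_cosets_quot_bij M sD)).
rewrite (big_morph (fun y : completed_algebra k G => y N) (id1:=0%R) (op1:=+%R)) //.
apply: etrans (sum_lcosets_eq0 (fun v => galg_pchar v kp) sHK pKH fK).
apply: eq_bigr => A /lcosetsP[q _ Aq].
have fA r : r \in A -> f r = f q.
  by rewrite Aq => /lcosetP[h Hh ->]; apply: fK; exact: (fintype.subsetP sHK).
have qA : q \in A by rewrite Aq (lcoset_refl H).
rewrite [RHS]fA; last exact: mem_repr qA.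
(* The representative in [ca_trace] need not project to [repr A], but [f] is constant on [A]. The
   default 1 is never taken, as the coset is nonempty. *)
set y := xget _ _.
have yA : \pi_(quot M) y \in A.
  rewrite /y; case: xgetP => [z -> //|noA].
  by have [z qz] := quot_pi q; case: (noA z) => /=; rewrite -qz.
by rewrite -(fA _ yA) /f quot_projE // -quot_piV.
Qed.

(** * Openness of the defect group *)

(** The index of [H] in [K :&: P] is a power of [p] since it divides [#|P|], and it divides
    [#|K : H|], which is prime to [p]; so it is 1. *)
Lemma pgroup_sub_pnat_index (p : nat) (gT : finGroupType) (H K P : {group gT}) :
  H \subset K -> H \subset P -> p.-nat #|P| -> ~~ (p %| #|K : H|%g) ->
  K :&: P \subset H.
Proof.
move=> sHK sHP pP pKH.
have sHQ : H \subset K :&: P by rewrite finset.subsetI sHK.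
have pQH : p.-nat #|K :&: P : H|%g.
  apply: pnat_dvd pP; apply: dvdn_trans (dvdn_indexg _ _) _.
  by rewrite cardSg ?finset.subsetIr.
rewrite -indexg_eq1; case/p_natP: pQH => -[-> //|m QH].
case/negP: pKH; rewrite -(Lagrange_index (finset.subsetIl K P) sHQ) QH.
by rewrite expnS mulnCA dvdn_mulr.
Qed.

Theorem proposition5p8 (p : nat) (k : fieldType) (kp : p \in [pchar k]%R)
    (G : profiniteType) (B : set (completed_algebra k G)) (hB : is_block B)
    (D : set G) (hD : is_defect_group B D)
    (P : set G) (hP : sylow_subgroup p P) (DP : D `<=` P) :
  open (D : set (subspace P)).
Proof.
have [e [[E [primE _ _] Ee] _] [[sD clD] eD _]] := hD.
have [[sP _] pP _] := hP.
have [_ e0 _] := primE e Ee.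
have [N eN] : exists N : open_normal G, e N <> 0%R.
  apply: contrapT => e00; apply: e0; apply: caP => N.
  by apply: contrapT => eN; apply: e00; exists N.
(* [DN] is to cut out [D] in [P]; the inclusion of [DN] ∩ [P] in [D] is tested modulo each [M]
   inside [N]. *)
apply/open_subspaceP; exists (setmulg D N); first exact: open_setmulg.
apply/seteqP; split=> x [] DNx Px; split=> //; last exact: sub_setmulg.
apply: (closed_bigcap_setmulg (N := N)) => // M MN.
have [y fy ey] := eD M I.
apply/setmulg_quot_image.
pose H := Group (group_set_quot_image M sD).
pose K := Group (group_set_quot_image M (subgroup_setmulg N sD)).
pose Q := Group (group_set_quot_image M sP).
have sHK : H \subset K.
  apply/fintype.subsetP => _ /quot_imageP[d Dd <-].
  by apply: mem_quot_image; exact: sub_setmulg.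
have sHQ : H \subset Q.
  apply/fintype.subsetP => _ /quot_imageP[d Dd <-].
  by apply: mem_quot_image; exact: DP.
(* Otherwise [e], being a trace from [DM], would vanish at [N]. *)
have pKH : ~~ (p %| #|K : H|%g).
  by apply/negP => pKH; apply: eN; rewrite -ey; exact: ca_trace_eq0 kp MN sD pKH fy.
have := pgroup_sub_pnat_index sHK sHQ (quot_image_pgroup M sP pP) pKH.
move=> /fintype.subsetP; apply; rewrite inE.
by rewrite !mem_quot_image.
Qed.
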